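(* For every $r\ge1$, the Genocchi numbers of the second kind $g(r)$ and the Legendre–Stirling numbers $d(r,j)$ satisfy $$g(r)=\sum_{j=1}^{r}(-1)^{r+j}(j!)^2\cdot d(r,j).$$
   Context: Genocchi numbers of the second kind (median Genocchi numbers) $g(r)$, $r\ge1$: $g(r)=G(r,1)$, where $G(1,x)=1$ and $G(r,x)=(x+1)^2G(r-1,x+1)-x(x+1)G(r-1,x)$ for all $x\ge0$ and $r\ge2$. (The sequence begins $1,2,8,56,608,\ldots$.) Legendre–Stirling numbers: $$d(i,j)=\sum_{\ell=1}^{j}\frac{(-1)^{\ell+j}(2\ell+1)(\ell^2+\ell)^i}{(\ell+j+1)!\,(j-\ell)!}.$$ *)

(* Defs.v *)
From mathcomp Require Import all_boot all_order all_algebra.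

Set Implicit Arguments.
Unset Strict Implicit.
Unset Printing Implicit Defensive.

Import Order.TTheory GRing.Theory Num.Theory.
Local Open Scope ring_scope.

(* The recurrence starts at r = 1; the value at r = 0 is a junk value. *)
Fixpoint G (r x : nat) : int :=
  match r with
  | 0 => 0
  | 1 => 1
  | r'.+1 => (x%:Z + 1) ^+ 2 * G r' x.+1 - x%:Z * (x%:Z + 1) * G r' x
  end.

(* Genocchi numbers of the second kind (median Genocchi numbers), r >= 1. *)
Definition genocchi2 (r : nat) : int := G r 1.

(* Legendre-Stirling numbers; the summation range l <= j makes the truncated
   subtraction j - l exact. *)
Definition legendre_stirling (i j : nat) : rat :=
  \sum_(1 <= l < j.+1)
    ((-1) ^+ (l + j) * (2 * l + 1)%N%:R * (l ^ 2 + l)%N%:R ^+ i)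
      / ((l + j + 1)`!%:R * (j - l)`!%:R).

(* Main.v *)
Require Import Defs.
From mathcomp Require Import all_boot all_order all_algebra.
From mathcomp Require Import ring lra zify.

Set Implicit Arguments.
Unset Strict Implicit.
Unset Printing Implicit Defensive.

Import Order.TTheory GRing.Theory Num.Theory.
Local Open Scope ring_scope.

(** The identity is the value at [x = 1] of an expansion of the whole polynomial
    [G r x] in Legendre-Stirling numbers.  Put [h r x = x!^2 * G r x]; the
    Genocchi recurrence becomes [h (r+1) x = h r (x+1) - x (x+1) h r x].  The
    Legendre-Stirling numbers satisfy the triangular recurrence
    [d(i+1,j) = d(i,j-1) + j (j+1) d(i,j)] with [d(1,j) = 1] if [j = 1] and [0]
    otherwise ([legendre_stirlingS], [legendre_stirling1]).  Hence an expansion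
    [h r x = sum_j (-1)^(r+j) H(j,x) d(r,j)] propagates from [r] to [r+1] as soon
    as [H(j+1,x) = H(j,x+1) + (j (j+1) - x (x+1)) H(j,x)], and it holds for
    [r = 1] when [H(1,x) = x!^2].  These two conditions define [H], called [kern]
    below with both indices shifted by one, and [genocchi_expansion] is the
    resulting expansion.

    It remains to see that [H(j,1) = j!^2].  No closed form of [H] is used:
    since [j (j+1) - x (x+1)] is antisymmetric in [j] and [x], the recurrence
    for [H] is invariant under exchanging the two indices, and this forces
    [H] to be symmetric ([kernC]), so that [H(j,1) = H(1,j) = j!^2]. *)

Lemma fact_neq0 (n : nat) : n`!%:R != 0 :> rat.
Proof. by rewrite pnatr_eq0 -lt0n fact_gt0. Qed.

(** Termwise, [l^2 + l = j (j+1) - (j-l) (j+l+1)], where now [j] is the upper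
    index: the second part cancels one factor of each factorial in the
    denominator and turns the [l]-th summand for [j] into that for [j - 1]. *)
Lemma legendre_stirlingS (i j : nat) :
  legendre_stirling i.+1 j.+1 =
  legendre_stirling i j + (j.+1 * j.+2)%:R * legendre_stirling i j.+1.
Proof.
have recr (F : nat -> rat) :
  \sum_(1 <= l < j.+2) F l = \sum_(1 <= l < j.+1) F l + F j.+1.
  by rewrite big_nat_recr.
rewrite /legendre_stirling !recr /=.
rewrite subnn mulrDr addrA; congr (_ + _); last first.
  by rewrite [_ ^+ i.+1]exprS (_ : (j.+1 ^ 2 + j.+1 = j.+1 * j.+2)%N); [ring | lia].
rewrite mulr_sumr -big_split /=; apply: eq_big_nat => l /andP[_ lt_lj].
have [k ->] : exists k, j = (l + k)%N by exists (j - l)%N; lia.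
rewrite (_ : (l + k).+1 - l = k.+1)%N; last by lia.
rewrite (_ : l + k - l = k)%N; last by lia.
rewrite (_ : l + (l + k).+1 + 1 = (l + (l + k) + 1).+1)%N; last by lia.
rewrite [(l + (l + k).+1)%N]addnS !factS.
rewrite ![_ ^+ i.+1]exprS ![(-1) ^+ _.+1]exprS !natrM.
have := fact_neq0 k; have := fact_neq0 (l + (l + k) + 1).
move: (k`!%:R : rat) (_`!%:R : rat) => u v v_neq0 u_neq0.
field; rewrite u_neq0 v_neq0.
by rewrite -[1]/(1%:R) -!natrD !pnatr_eq0.
Qed.

(** The sum telescopes; the right-hand side is the discrete antiderivative
    given by Gosper's algorithm. It serves to sum [legendre_stirling 0 j.+1]. *)
Lemma legendre_stirling_partial (j m : nat) : (m <= j.+1)%N ->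
  \sum_(0 <= l < m) (-1) ^+ l * (2 * l + 1)%:R /
     ((l + j.+1 + 1)`!%:R * (j.+1 - l)`!%:R) =
  - (-1) ^+ m * m%:R / (j.+1%:R * ((m + j.+1)`!%:R * (j.+1 - m)`!%:R)) :> rat.
Proof.
elim: m => [|m IHm] le_mj; first by rewrite big_nil mulr0 mul0r.
rewrite big_nat_recr //= IHm; last exact: ltnW.
have [k ->] : exists k, j = (m + k)%N by exists (j - m)%N; lia.
rewrite (_ : (m + k).+1 - m = k.+1)%N; last by lia.
rewrite (_ : (m + k).+1 - m.+1 = k)%N; last by lia.
rewrite (_ : m + (m + k).+1 + 1 = (m + (m + k).+1).+1)%N; last by lia.
rewrite addSn !factS.
rewrite exprS !natrM.
have := fact_neq0 k; have := fact_neq0 (m + (m + k).+1).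
move: (k`!%:R : rat) (_`!%:R : rat) => u v v_neq0 u_neq0.
field; rewrite u_neq0 v_neq0.
by rewrite -[1]/(1%:R) -!natrD !pnatr_eq0.
Qed.

(** With the term [l = 0] included, the alternating sum vanishes; the value is
    therefore the opposite of that missing term. *)
Lemma legendre_stirling0 (j : nat) :
  legendre_stirling 0 j.+1 = (-1) ^+ j / (j.+2`!%:R * j.+1`!%:R).
Proof.
have := @legendre_stirling_partial j j.+1 (leqnn _).
rewrite big_ltn // subnn => partial.
(* The last term [l = j.+1] is kept apart: the partial sum up to it is known in
   closed form and cancels it, leaving the term [l = 0]. *)
rewrite /legendre_stirling big_nat_recr //=.
rewrite (eq_bigr (fun l => (-1) ^+ j.+1 * ((-1) ^+ l * (2 * l + 1)%:R /
     ((l + j.+1 + 1)`!%:R * (j.+1 - l)`!%:R)))); last first.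
  by move=> l _; rewrite expr0 mulr1 exprD; ring.
rewrite -mulr_sumr.
move/(canRL (addKr _)): partial => ->.
rewrite expr0 subnn (_ : (j.+1 + j.+1 + 1 = (j.+1 + j.+1).+1)%N); last by lia.
rewrite (_ : (0 + j.+1 + 1 = j.+2)%N); last by lia.
rewrite subn0 exprD exprS fact0 [(_.+1 + _).+1`!]factS.
have := fact_neq0 j.+2; have := fact_neq0 j.+1.
have := fact_neq0 (j.+1 + j.+1).
rewrite [((j.+1 + j.+1).+1 * _)%:R]natrM.
move: (_`!%:R : rat) (j.+1`!%:R : rat) (j.+2`!%:R : rat) => u v w un vn wn.
field; rewrite un vn wn.
by rewrite -[1]/(1%:R) -!natrD !pnatr_eq0.
Qed.

Lemma legendre_stirling1 (j : nat) : legendre_stirling 1 j.+1 = (j == 0)%:R.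
Proof.
rewrite legendre_stirlingS legendre_stirling0.
case: j => [|j].
  rewrite /legendre_stirling big_nil !factS fact0 expr0 add0r.
  rewrite -[(0 == 0)%:R]/(1 : rat) !muln1 mul1n mul1r mulr1.
  by rewrite divff.
rewrite -[(j.+1 == 0)%:R]/(0 : rat) legendre_stirling0 !factS exprS.
rewrite !natrM; field; rewrite fact_neq0.
by rewrite -[1]/(1%:R) -!natrD !pnatr_eq0.
Qed.

Lemma legendre_stirling_gt (i j : nat) : (i < j)%N -> legendre_stirling i.+1 j.+1 = 0.
Proof.
elim: i j => [|i IHi] [|j] // lt_ij; first by rewrite legendre_stirling1.
by rewrite legendre_stirlingS !IHi ?mulr0 ?addr0 // ltnW.
Qed.

(** [kern a b] is the coefficient [H(a+1,b+1)] of the introduction; in shifted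
    indices, [(a+1)(a+2) - (b+1)(b+2) = (a - b)(a + b + 3)]. *)
Fixpoint kern (a b : nat) : rat :=
  if a is a'.+1 then
    kern a' b.+1 + (a'%:R - b%:R) * (a' + b + 3)%:R * kern a' b
  else b.+1`!%:R ^+ 2.

Lemma kernS (a b : nat) :
  kern a.+1 b = kern a b.+1 + (a%:R - b%:R) * (a + b + 3)%:R * kern a b.
Proof. by []. Qed.

(** The antisymmetric part [A] of [kern], assuming symmetry on the
    antidiagonals below, obeys the recurrence without its product term, so it
    is constant along the next antidiagonal; being also antisymmetric, it
    vanishes there. *)
Lemma kernC (a b : nat) : kern a b = kern b a.
Proof.
have [n le_n] : exists n, (a + b <= n)%N by exists (a + b)%N.
elim: n => [|n IHn] in a b le_n *; first by have [-> ->] : a = 0 /\ b = 0 by lia.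
pose A x y := kern x y - kern y x.
have AS x y : (x + y <= n)%N -> A x.+1 y = A x y.+1.
  by move=> le_xy; rewrite /A !kernS (IHn x y) // (addnC y x); ring.
have A0 c x : (c + x <= n.+1)%N -> A x c = A 0 (c + x)%N.
  elim: x c => [|x IHx] c le_cx; first by rewrite addn0.
  by rewrite AS ?IHx; [rewrite addSnnS | lia | lia].
have Aab : A a b = A b a by rewrite (A0 b a) 1?(A0 a b) 1?(addnC b a).
apply/eqP; move: Aab; rewrite /A => Aab; lra.
Qed.

(** Induction on [r]: in the sum for [r.+1], the recurrence of
    [legendre_stirling] produces a part shifted in [a], which meets [kern a.+1 b],
    and an unshifted part; the recurrence of [kern] then matches the one of [G]
    after scaling by the squared factorial. *)
Lemma genocchi_expansion (r b : nat) :
  b.+1`!%:R ^+ 2 * (G r.+1 b.+1)%:~R =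
  \sum_(0 <= a < r.+1) (-1) ^+ (r + a) * kern a b * legendre_stirling r.+1 a.+1.
Proof.
elim: r b => [|r IHr] b.
  by rewrite big_nat1 legendre_stirling1 /= mul1r.
have -> : b.+1`!%:R ^+ 2 * (G r.+2 b.+1)%:~R =
  b.+2`!%:R ^+ 2 * (G r.+1 b.+2)%:~R
  - (b.+1 * b.+2)%:R * (b.+1`!%:R ^+ 2 * (G r.+1 b.+1)%:~R) :> rat.
  have -> : G r.+2 b.+1 =
    (b.+1%:Z + 1) ^+ 2 * G r.+1 b.+2 - b.+1%:Z * (b.+1%:Z + 1) * G r.+1 b.+1 by [].
  rewrite [b.+2`!]factS !natrM rmorphB !rmorphM /= !rmorphD /=; ring.
rewrite !IHr.
pose S := \sum_(0 <= a < r.+1)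
  (-1) ^+ (r + a) * kern a.+1 b * legendre_stirling r.+1 a.+1.
pose U := \sum_(0 <= a < r.+1)
  (-1) ^+ (r + a) * (a.+1 * a.+2)%:R * kern a b * legendre_stirling r.+1 a.+1.
have -> : \sum_(0 <= a < r.+2)
    (-1) ^+ (r.+1 + a) * kern a b * legendre_stirling r.+2 a.+1 = S - U.
  rewrite (eq_bigr (fun a => 
    (-1) ^+ (r.+1 + a) * kern a b * legendre_stirling r.+1 a +
    (-1) ^+ (r.+1 + a) * (a.+1 * a.+2)%:R * kern a b * legendre_stirling r.+1 a.+1));
    last by move=> a _; rewrite legendre_stirlingS; ring.
  (* The shifted part loses its [a = 0] term, as [legendre_stirling r.+1 0] is an
     empty sum, and the unshifted part its last one, by vanishing above the
     diagonal. *)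
  rewrite big_split /= big_nat_recl // [X in _ + X]big_nat_recr //=.
  rewrite (legendre_stirling_gt (ltnSn r)) mulr0 addr0.
  rewrite {1}/legendre_stirling big_nil mulr0 add0r -sumrN; congr (_ + _).
    by apply: eq_bigr => a _; rewrite ?kernS addSnnS !addnS !exprS; ring.
  by apply: eq_bigr => a _; rewrite addSn exprS; ring.
rewrite mulr_sumr -!sumrN -!big_split /=; apply: eq_bigr => a _.
by rewrite !natrM !natrD; ring.
Qed.

Theorem corollary5p5 (r : nat) (hr : (1 <= r)%N) :
  (genocchi2 r)%:~R =
    \sum_(1 <= j < r.+1)
      (-1) ^+ (r + j) * (j`!)%:R ^+ 2 * legendre_stirling r j :> rat.
Proof.
case: r hr => // r _.
have := genocchi_expansion r 0; rewrite expr1n mul1r => ->.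
rewrite big_add1; apply: eq_bigr => a _.
by rewrite kernC /= addSn addnS !exprS; ring.
Qed.
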